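(* (Uniqueness Theorem) Let $\gamma,\beta: I\to\mathbb{M}^4$ be two null Cartan curves parameterized by the same pseudo-de Sitter parameter $\sigma$, where $I\subset\mathbb{R}$ is an open interval. Suppose that $\gamma$ and $\beta$ have the same shape Cartan curvatures, $\tilde\tau_\gamma=\tilde\tau_\beta$ and $\tilde\kappa_\gamma=\tilde\kappa_\beta$ for any $\sigma\in I$. Then there exists an $f\in\mathbf{Simp}(\mathbb{M}^4)$ such that $\beta=f\circ\gamma$.
   Context: $\mathbb{M}^4$ is Minkowski space-time: $\mathbb{R}^4$ with the Lorentzian inner product $\mathbf{u}\cdot\mathbf{v}=-u_1v_1+u_2v_2+u_3v_3+u_4v_4$. A basis $\{\mathbf{L},\mathbf{N},\mathbf{W}_1,\mathbf{W}_2\}$ of $\mathbb{M}^4$ is pseudo-orthonormal if $\mathbf{L}\cdot\mathbf{L}=\mathbf{N}\cdot\mathbf{N}=0$, $\mathbf{L}\cdot\mathbf{N}=1$, $\mathbf{L}\cdot\mathbf{W}_i=\mathbf{N}\cdot\mathbf{W}_i=\mathbf{W}_1\cdot\mathbf{W}_2=0$ and $\mathbf{W}_i\cdot\mathbf{W}_i=1$ for $i=1,2$. A curve $\gamma$ in $\mathbb{M}^4$ is null if $\gamma'(t)\neq0$ is a null vector ($\gamma'\cdot\gamma'=0$) for all $t$. When $\gamma''\cdot\gamma''\neq0$, its pseudo-arc parameter is $s=\int_{t_0}^t(\gamma''(u)\cdot\gamma''(u))^{1/4}du$. A null curve with $\gamma''\cdot\gamma''\neq0$ is a Cartan curve if $F_\gamma=\{\gamma',\gamma'',\gamma^{(3)},\gamma^{(4)}\}$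 is linearly independent for every $t$. Its Cartan frame, with respect to the pseudo-arc parameter, is the unique frame $\{\mathbf{L},\mathbf{N},\mathbf{W}_1,\mathbf{W}_2\}$ that is pseudo-orthonormal, positively oriented, has the same orientation as $F_\gamma$, and satisfies (with $'=d/ds$) $$\gamma'=\mathbf{L},\quad \mathbf{L}'=\mathbf{W}_1,\quad \mathbf{N}'=\kappa\mathbf{W}_1+\tau\mathbf{W}_2,\quad \mathbf{W}_1'=-\kappa\mathbf{L}-\mathbf{N},\quad \mathbf{W}_2'=-\tau\mathbf{L}.$$ The functions $\kappa,\tau$ (written $\kappa_\gamma,\tau_\gamma$) are the Cartan curvatures of $\gamma$; in the pseudo-arc parameter their values are given as $$\kappa=\tfrac12\,\gamma^{(3)}\cdot\gamma^{(3)},\qquad \tau=-\sqrt{\gamma^{(4)}\cdot\gamma^{(4)}-(\gamma^{(3)}\cdot\gamma^{(3)})^2}.$$ The pseudo-de Sitter parameter $\sigma=\sigma_\gamma$ of $\gamma$ is the pseudo-arc parameter of the null curve $s\mapsto\mathbf{W}_2(s)$ (which lies on de Sitter 3-space $\{\mathbf{u}:\mathbf{u}\cdot\mathbf{u}=1\}$), given by $d\sigma_\gamma=\sqrt{\tau_\gamma}\,ds$. The shape Cartan curvatures of $\gamma$ are $$\tilde\tau_\gamma=\frac{-d\tau_\gamma}{2\tau_\gamma\,d\sigma_\gamma},\qquad \tilde\kappa_\gamma=\frac{\kappa_\gamma}{\tau_\gamma}.$$ A null rotation is a mapping $\varphi$ of one pseudo-orthonormal basis $(\bar{\mathbf{L}},\bar{\mathbf{N}},\bar{\mathbf{W}}_1,\bar{\mathbf{W}}_2)$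 onto another $(\mathbf{L},\mathbf{N},\mathbf{W}_1,\mathbf{W}_2)$ given by $$\begin{bmatrix}\mathbf{L}\\ \mathbf{N}\\ \mathbf{W}_1\\ \mathbf{W}_2\end{bmatrix}=\begin{bmatrix}\lambda&0&0&0\\ -\frac12\lambda(\varepsilon^2+\zeta^2)&\lambda^{-1}&-\varepsilon&\zeta\\ \lambda\varepsilon\cos\theta+\lambda\zeta\sin\theta&0&\cos\theta&-\sin\theta\\ \lambda\varepsilon\sin\theta-\lambda\zeta\cos\theta&0&\sin\theta&\cos\theta\end{bmatrix}\begin{bmatrix}\bar{\mathbf{L}}\\ \bar{\mathbf{N}}\\ \bar{\mathbf{W}}_1\\ \bar{\mathbf{W}}_2\end{bmatrix}$$ with $\lambda,\varepsilon,\zeta,\theta$ real constants, $\lambda\neq0$; it preserves orientation and is equivalent to a Lorentzian transformation. A p-similarity (pseudo-similarity) is a map $f:\mathbb{M}^4\to\mathbb{M}^4$, $f(x)=\mu\varphi(x)+\mathbf{b}$, with $\mu\neq0$ a real constant, $\varphi$ a null rotation and $\mathbf{b}$ a translation vector. $\mathbf{Simp}(\mathbb{M}^4)$ is the group of all p-similarities under composition. *)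

(* Defs.v *)
From mathcomp Require Import all_boot all_order all_algebra.
From mathcomp Require Import all_classical all_reals all_analysis.
Import Order.TTheory GRing.Theory Num.Theory numFieldNormedType.Exports.

Set Implicit Arguments.
Unset Strict Implicit.
Unset Printing Implicit Defensive.

Local Open Scope ring_scope.
Local Open Scope classical_set_scope.

Section Minkowski.
Context {R : realType}.
Implicit Types (u v : 'rV[R]_4) (A B : 'M[R]_4).

(* The time-like coordinate is the one with index 0. *)
Definition mdot u v : R :=
  - (u 0 0 * v 0 0) + u 0 1 * v 0 1 + u 0 2 * v 0 2 + u 0 3 * v 0 3.

Definition mx_of_rows u0 u1 u2 u3 : 'M[R]_4 :=
  \matrix_(i < 4) nth 0 [:: u0; u1; u2; u3] i.

Definition pseudo_orthonormal (L N W1 W2 : 'rV[R]_4) : Prop :=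
  [/\ row_free (mx_of_rows L N W1 W2),
      mdot L L = 0 /\ mdot N N = 0, mdot L N = 1,
      [/\ mdot L W1 = 0, mdot L W2 = 0, mdot N W1 = 0, mdot N W2 = 0
        & mdot W1 W2 = 0]
    & mdot W1 W1 = 1 /\ mdot W2 W2 = 1].

Definition positively_oriented A : Prop := 0 < \det A.

Definition same_orientation A B : Prop := 0 < \det A * \det B.

Definition null_rotation_mx (lambda eps zeta theta : R) : 'M[R]_4 :=
  let c := cos theta in let s := sin theta in
  \matrix_(i < 4, j < 4) nth 0 (nth [::]
    [:: [:: lambda; 0; 0; 0];
        [:: - (2^-1 * lambda * (eps ^+ 2 + zeta ^+ 2)); lambda^-1; - eps; zeta];
        [:: lambda * eps * c + lambda * zeta * s; 0; c; - s];
        [:: lambda * eps * s - lambda * zeta * c; 0; s; c]] i) j.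

(* The reference pseudo-orthonormal basis is not fixed once and for all: each
   null rotation comes with its own one, so that null rotations with different
   invariant null directions can be composed. *)
Definition null_rotation (phi : {linear 'rV[R]_4 -> 'rV[R]_4}) : Prop :=
  exists L N W1 W2 : 'rV[R]_4, pseudo_orthonormal L N W1 W2 /\
  exists lambda eps zeta theta : R, lambda != 0 /\
    mx_of_rows (phi L) (phi N) (phi W1) (phi W2) =
    null_rotation_mx lambda eps zeta theta *m mx_of_rows L N W1 W2.

Definition p_similarity (f : 'rV[R]_4 -> 'rV[R]_4) : Prop :=
  exists (mu : R) (phi : {linear 'rV[R]_4 -> 'rV[R]_4}) (b : 'rV[R]_4),
    [/\ mu != 0, null_rotation phi & forall x, f x = mu *: phi x + b].

End Minkowski.

Section Curves.
Context {R : realType}.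
Implicit Types (I : set R) (c X : R -> 'rV[R]_4).

Definition smooth_on I X : Prop :=
  forall (n : nat) (t : R), I t -> derivable (derive1n n X) t 1.

Definition null_curve I c : Prop :=
  smooth_on I c /\
  forall t, I t -> derive1 c t != 0 /\ mdot (derive1 c t) (derive1 c t) = 0.

(* ds/dt for the pseudo-arc parameter
   s = \int_(t0)^t (c'' . c'')^(1/4) of a null curve c. *)
Definition pseudo_arc_speed c (t : R) : R :=
  mdot (derive1n 2 c t) (derive1n 2 c t) `^ 4^-1.

(* The derivative d/ds with respect to the pseudo-arc parameter s of c of a
   vector field X along c, both being given as functions of the parameter t. *)
Definition arc_derive c X (t : R) : 'rV[R]_4 :=
  (pseudo_arc_speed c t)^-1 *: derive1 X t.

Definition derivatives_mx c (t : R) : 'M[R]_4 :=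
  mx_of_rows (derive1 c t) (derive1n 2 c t) (derive1n 3 c t) (derive1n 4 c t).

Definition cartan_curve I c : Prop :=
  null_curve I c /\
  forall t, I t ->
    mdot (derive1n 2 c t) (derive1n 2 c t) != 0 /\ row_free (derivatives_mx c t).

(* A smooth frame field along c together with two functions kappa and tau,
   all expressed in the given parameter t of c. *)
Record frame_field := FrameField {
  frL : R -> 'rV[R]_4;
  frN : R -> 'rV[R]_4;
  frW1 : R -> 'rV[R]_4;
  frW2 : R -> 'rV[R]_4;
  kappa : R -> R;
  tau : R -> R }.

Definition frame_mx (F : frame_field) (t : R) : 'M[R]_4 :=
  mx_of_rows (frL F t) (frN F t) (frW1 F t) (frW2 F t).

(* The two orientation conditions together with the Frenet equations force
   tau < 0, since det(c', c'', c''', c'''') = - tau (ds/dt)^10 det(frame). *)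
Definition cartan_frame I c (F : frame_field) : Prop :=
  [/\ [/\ smooth_on I (frL F), smooth_on I (frN F),
          smooth_on I (frW1 F) & smooth_on I (frW2 F)],
      forall t, I t -> pseudo_orthonormal (frL F t) (frN F t) (frW1 F t) (frW2 F t),
      forall t, I t -> positively_oriented (frame_mx F t),
      forall t, I t -> same_orientation (frame_mx F t) (derivatives_mx c t)
    & forall t, I t ->
      [/\ arc_derive c c t = frL F t,
          arc_derive c (frL F) t = frW1 F t,
          arc_derive c (frN F) t = kappa F t *: frW1 F t + tau F t *: frW2 F t,
          arc_derive c (frW1 F) t = - (kappa F t *: frL F t) - frN F t
        & arc_derive c (frW2 F) t = - (tau F t *: frL F t)]].

(* dsigma/dt for the pseudo-de Sitter parameter sigma, i.e. the pseudo-arc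
   parameter of W2.  As dW2/ds = - tau L, it equals sqrt |tau| * ds/dt. *)
Definition de_sitter_speed (F : frame_field) (t : R) : R :=
  pseudo_arc_speed (frW2 F) t.

Definition de_sitter_parametrized I (F : frame_field) : Prop :=
  forall t, I t -> de_sitter_speed F t = 1.

Definition shape_tau (F : frame_field) (t : R) : R :=
  - derive1 (tau F) t / (2 * tau F t * de_sitter_speed F t).

Definition shape_kappa (F : frame_field) (t : R) : R :=
  kappa F t / tau F t.

End Curves.

Arguments frame_field : clear implicits.

(* Main.v *)
(* With respect to sigma, a null Cartan curve has pseudo-arc speed
   v = ds/dsigma satisfying v^2 tau = -1, so its shape curvature shape_tau is
   v'/v.  Equality of the shape curvatures thus gives v_beta = mu v_gamma for a
   constant mu > 0, tau_beta = tau_gamma / mu^2, kappa_beta = kappa_gamma / mu^2,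
   and the rescaled frame (L / mu, mu N, W1, W2) of beta solves the same linear
   system as the frame of gamma.  The linear map phi carrying the latter frame to
   the former does not depend on sigma, and beta' = mu^2 phi(gamma'), whence
   beta = mu^2 phi(gamma) + b.

   It remains to see that a Lorentz isometry phi of positive determinant is a
   null rotation, i.e. preserves a null line.  If phi moves the line of a null
   vector L, then in a frame (L, N, W1, W2) with phi L on the line of N the map
   induced by phi between the W-planes has determinant -1, hence is a reflection,
   and an invariant null line is obtained from a real root of an explicit
   quartic. *)
From HB Require Import structures.
Require Import Defs.
From mathcomp Require Import all_boot all_order all_algebra.
From mathcomp Require Import all_classical all_reals all_analysis.
From mathcomp Require Import ring lra.
Import Order.TTheory GRing.Theory Num.Theory numFieldNormedType.Exports.

Set Implicit Arguments.
Unset Strict Implicit.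
Unset Printing Implicit Defensive.

Local Open Scope ring_scope.
Local Open Scope classical_set_scope.

(** * Inner products, expansions and determinants in pseudo-orthonormal frames *)

Section LorentzianFrames.
Context {R : realType}.
Implicit Types (u v w x y L N : 'rV[R]_4).

Lemma mdotC u v : mdot u v = mdot v u.
Proof. by rewrite /mdot; ring. Qed.

Lemma mdotDl u v w : mdot (u + v) w = mdot u w + mdot v w.
Proof. by rewrite /mdot !mxE; ring. Qed.

Lemma mdotDr u v w : mdot u (v + w) = mdot u v + mdot u w.
Proof. by rewrite /mdot !mxE; ring. Qed.

Lemma mdotNl u v : mdot (- u) v = - mdot u v.
Proof. by rewrite /mdot !mxE; ring. Qed.

Lemma mdotNr u v : mdot u (- v) = - mdot u v.
Proof. by rewrite /mdot !mxE; ring. Qed.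

Lemma mdotZl (a : R) u v : mdot (a *: u) v = a * mdot u v.
Proof. by rewrite /mdot !mxE; ring. Qed.

Lemma mdotZr (a : R) u v : mdot u (a *: v) = a * mdot u v.
Proof. by rewrite /mdot !mxE; ring. Qed.

Lemma mdot0l u : mdot 0 u = 0.
Proof. by rewrite /mdot !mxE; ring. Qed.

Lemma mdot0r u : mdot u 0 = 0.
Proof. by rewrite /mdot !mxE; ring. Qed.

Definition mdotE := (mdotDl, mdotDr, mdotNl, mdotNr, mdotZl, mdotZr).

Lemma pseudo_orthonormal_dots {L N W1 W2 : 'rV[R]_4} :
  pseudo_orthonormal L N W1 W2 ->
  (mdot L L = 0) * (mdot L N = 1) * (mdot L W1 = 0) * (mdot L W2 = 0) *
  (mdot N L = 1) * (mdot N N = 0) * (mdot N W1 = 0) * (mdot N W2 = 0) *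
  (mdot W1 L = 0) * (mdot W1 N = 0) * (mdot W1 W1 = 1) * (mdot W1 W2 = 0) *
  (mdot W2 L = 0) * (mdot W2 N = 0) * (mdot W2 W1 = 0) * (mdot W2 W2 = 1).
Proof.
case=> _ [LL NN] LN [LW1 LW2 NW1 NW2 W12] [W11 W22].
rewrite (mdotC N L) (mdotC W1 L) (mdotC W1 N) (mdotC W2 L) (mdotC W2 N).
by rewrite (mdotC W2 W1).
Qed.

Lemma sum_ord4 (V : nmodType) (f : 'I_4 -> V) :
  \sum_i f i = f 0 + f 1 + f 2 + f 3.
Proof.
rewrite 4!big_ord_recl big_ord0 addr0 !addrA.
by congr (f _ + f _ + f _ + f _); apply/val_inj.
Qed.

Lemma forall_ord4 (P : 'I_4 -> Prop) : P 0 -> P 1 -> P 2 -> P 3 -> forall i, P i.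
Proof.
by move=> P0 P1 P2 P3 [[|[|[|[|//]]]] i4];
  [move: P0 | move: P1 | move: P2 | move: P3]; congr (P _); apply/val_inj.
Qed.

(* The Gram matrix of a pseudo-orthonormal frame is its own inverse and swaps L
   and N, so the inverse of the frame matrix has the columns eta N, eta L, eta W1,
   eta W2 with eta = diag(-1, 1, 1, 1). *)
Definition dual_frame_mx (L N W1 W2 : 'rV[R]_4) : 'M[R]_4 :=
  \matrix_(i < 4, j < 4)
    ((if i == 0 then -1 else 1) * nth 0 [:: N; L; W1; W2] j 0 i).

Lemma mulmx_dual_frame (L N W1 W2 u : 'rV[R]_4) :
  u *m dual_frame_mx L N W1 W2 =
  \row_(j < 4) nth 0 [:: mdot u N; mdot u L; mdot u W1; mdot u W2] j.
Proof.
apply/rowP; apply: forall_ord4;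
  by rewrite !mxE sum_ord4 !mxE /mdot /= !mulN1r !mul1r mulrN.
Qed.

Lemma row_mulmx_frame (a : 'rV[R]_4) (L N W1 W2 : 'rV[R]_4) :
  a *m mx_of_rows L N W1 W2 = a 0 0 *: L + a 0 1 *: N + a 0 2 *: W1 + a 0 3 *: W2.
Proof. by apply/rowP=> j; rewrite !mxE sum_ord4 !mxE. Qed.

(** The entries of the product with the dual matrix are inner products of frame vectors, so the Gram
    relations alone give an inverse and hence linear independence. *)
Lemma gram_pseudo_orthonormal (L N W1 W2 : 'rV[R]_4) :
  mdot L L = 0 -> mdot N N = 0 -> mdot L N = 1 ->
  mdot L W1 = 0 -> mdot L W2 = 0 -> mdot N W1 = 0 -> mdot N W2 = 0 ->
  mdot W1 W2 = 0 -> mdot W1 W1 = 1 -> mdot W2 W2 = 1 ->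
  pseudo_orthonormal L N W1 W2 /\
  mx_of_rows L N W1 W2 *m dual_frame_mx L N W1 W2 = 1%:M.
Proof.
move=> LL NN LN LW1 LW2 NW1 NW2 W12 W11 W22.
have FD : mx_of_rows L N W1 W2 *m dual_frame_mx L N W1 W2 = 1%:M.
  apply/row_matrixP; apply: forall_ord4;
  rewrite row_mul rowK /= mulmx_dual_frame ?(mdotC N L, mdotC W1 L, mdotC W1 N)
    ?(mdotC W2 L, mdotC W2 N, mdotC W2 W1);
  rewrite ?LL ?NN ?LN ?LW1 ?LW2 ?NW1 ?NW2 ?W12 ?W11 ?W22;
  by apply/rowP; apply: forall_ord4; rewrite !mxE.
split=> //; split=> //.
by rewrite row_free_unit; case: (mulmx1_unit FD).
Qed.

(** The right inverse of the frame matrix is also a left inverse. As [L] and [N] are dual to each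
    other, the coefficient along [L] is the product with [N], and conversely. *)
Lemma frame_expansion (L N W1 W2 u : 'rV[R]_4) :
  pseudo_orthonormal L N W1 W2 ->
  u = mdot u N *: L + mdot u L *: N + mdot u W1 *: W1 + mdot u W2 *: W2.
Proof.
move=> [_ [LL NN] LN [LW1 LW2 NW1 NW2 W12] [W11 W22]].
have [_ /mulmx1C FD] :=
  gram_pseudo_orthonormal LL NN LN LW1 LW2 NW1 NW2 W12 W11 W22.
rewrite -[LHS]mulmx1 -FD mulmxA mulmx_dual_frame row_mulmx_frame.
by rewrite !mxE.
Qed.

(** Has the same form as the body of [null_rotation_mx], so that the two can be matched entry by
    entry. *)
Definition mx_of_lists (s : seq (seq R)) : 'M[R]_4 :=
  \matrix_(i < 4, j < 4) nth 0 (nth [::] s i) j.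

Lemma mx_of_lists_mul (L N W1 W2 : 'rV[R]_4) a0 a1 a2 a3 b0 b1 b2 b3 c0 c1 c2 c3
    d0 d1 d2 d3 :
  mx_of_lists [:: [:: a0; a1; a2; a3]; [:: b0; b1; b2; b3];
                  [:: c0; c1; c2; c3]; [:: d0; d1; d2; d3]] *m
  mx_of_rows L N W1 W2 =
  mx_of_rows (a0 *: L + a1 *: N + a2 *: W1 + a3 *: W2)
             (b0 *: L + b1 *: N + b2 *: W1 + b3 *: W2)
             (c0 *: L + c1 *: N + c2 *: W1 + c3 *: W2)
             (d0 *: L + d1 *: N + d2 *: W1 + d3 *: W2).
Proof.
apply/row_matrixP; apply: forall_ord4;
  by rewrite row_mul row_mulmx_frame !mxE rowK.
Qed.

(** Laplace expansion along the first two rows, by complementary 2x2 minors. *)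
Lemma det_mx_of_lists a0 a1 a2 a3 b0 b1 b2 b3 c0 c1 c2 c3 d0 d1 d2 d3 :
  \det (mx_of_lists [:: [:: a0; a1; a2; a3]; [:: b0; b1; b2; b3];
                        [:: c0; c1; c2; c3]; [:: d0; d1; d2; d3]]) =
  (a0 * b1 - a1 * b0) * (c2 * d3 - c3 * d2) -
  (a0 * b2 - a2 * b0) * (c1 * d3 - c3 * d1) +
  (a0 * b3 - a3 * b0) * (c1 * d2 - c2 * d1) +
  (a1 * b2 - a2 * b1) * (c0 * d3 - c3 * d0) -
  (a1 * b3 - a3 * b1) * (c0 * d2 - c2 * d0) +
  (a2 * b3 - a3 * b2) * (c0 * d1 - c1 * d0).
Proof.
rewrite (expand_det_row _ ord0) 4!big_ord_recl big_ord0 /cofactor.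
rewrite !(@expand_det_row _ 3 _ ord0) !big_ord_recl !big_ord0 /cofactor.
rewrite !(@expand_det_row _ 2 _ ord0) !big_ord_recl !big_ord0 /cofactor.
rewrite !det_mx11 !mxE /=.
rewrite !(exprS, expr0) /=.
ring.
Qed.

End LorentzianFrames.

(** * Isometries with a null eigenvector are null rotations *)

Section NullRotations.
Context {R : realType}.
Implicit Types (L N u v w x y : 'rV[R]_4).

Definition isometric (phi : 'rV[R]_4 -> 'rV[R]_4) :=
  forall x y, mdot (phi x) (phi y) = mdot x y.

Lemma mx_of_rows_linear (phi : {linear 'rV[R]_4 -> 'rV[R]_4})
    L N (W1 W2 : 'rV[R]_4) :
  mx_of_rows (phi L) (phi N) (phi W1) (phi W2) =
  mx_of_rows L N W1 W2 *m lin1_mx phi.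
Proof.
apply/row_matrixP; apply: forall_ord4;
  by rewrite row_mul !rowK /= mul_rV_lin1.
Qed.

(** The sine is nonnegative at [acos c], so the sign of [s] decides between [acos c] and its
    opposite. *)
Lemma exists_angle (c s : R) : c ^+ 2 + s ^+ 2 = 1 ->
  exists theta, cos theta = c /\ sin theta = s.
Proof.
move=> cs1.
have c1 : -1 <= c <= 1 by have := sqr_ge0 s; nra.
have sqs : Num.sqrt (1 - c ^+ 2) = `|s|.
  by rewrite -cs1 addrAC subrr add0r sqrtr_sqr.
have [s0|s0] := leP 0 s.
  by exists (acos c); rewrite acosK ?in_itv//= sin_acos// sqs ger0_norm.
exists (- acos c); rewrite cosN acosK ?in_itv//= sinN sin_acos// sqs.
by rewrite ltr0_norm// opprK.
Qed.

Lemma det_frame_change (phi : {linear 'rV[R]_4 -> 'rV[R]_4})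
    L N (W1 W2 : 'rV[R]_4)
    a0 a1 a2 a3 b0 b1 b2 b3 c0 c1 c2 c3 d0 d1 d2 d3 :
  pseudo_orthonormal L N W1 W2 ->
  phi L = a0 *: L + a1 *: N + a2 *: W1 + a3 *: W2 ->
  phi N = b0 *: L + b1 *: N + b2 *: W1 + b3 *: W2 ->
  phi W1 = c0 *: L + c1 *: N + c2 *: W1 + c3 *: W2 ->
  phi W2 = d0 *: L + d1 *: N + d2 *: W1 + d3 *: W2 ->
  \det (lin1_mx phi) =
  \det (mx_of_lists [:: [:: a0; a1; a2; a3]; [:: b0; b1; b2; b3];
                        [:: c0; c1; c2; c3]; [:: d0; d1; d2; d3]]).
Proof.
move=> [+ _ _ _ _] eL eN eW1 eW2; rewrite row_free_unit unitmxE unitfE => F0.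
apply: (mulfI F0); rewrite -det_mulmx -mx_of_rows_linear eL eN eW1 eW2.
by rewrite -mx_of_lists_mul det_mulmx mulrC.
Qed.

(** Pairing with [phi L = lambda *: L] fixes all components along [N]. The W-block is then
    orthogonal, and it is a rotation because its determinant is that of [phi]. Orthogonality of
    [phi N] to itself and to the images of the W's gives the remaining entries. *)
Lemma null_rotation_of_null_eigenvector
    (phi : {linear 'rV[R]_4 -> 'rV[R]_4}) L N (W1 W2 : 'rV[R]_4) (lambda : R) :
  pseudo_orthonormal L N W1 W2 -> isometric phi ->
  0 < \det (lin1_mx phi) -> lambda != 0 -> phi L = lambda *: L ->
  null_rotation phi.
Proof.
move=> F iso detphi l0 eL.
have D := pseudo_orthonormal_dots F.
have dotL x : mdot (phi x) L = lambda^-1 * mdot x L.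
  by rewrite -(iso x L) eL mdotZr mulKf.
have eN := frame_expansion (phi N) F.
have eW1 := frame_expansion (phi W1) F.
have eW2 := frame_expansion (phi W2) F.
rewrite !dotL !D mulr1 ?mulr0 in eN eW1 eW2.
have := iso N N; have := iso N W1; have := iso N W2.
have := iso W1 W1; have := iso W1 W2; have := iso W2 W2.
move: eN eW1 eW2.
move: (mdot (phi N) N) (mdot (phi N) W1) (mdot (phi N) W2) => n0 n1 n2.
move: (mdot (phi W1) N) (mdot (phi W1) W1) (mdot (phi W1) W2) => a1 c d.
move: (mdot (phi W2) N) (mdot (phi W2) W1) (mdot (phi W2) W2) => a2 e f.
move=> eN eW1 eW2.
have eL' : phi L = lambda *: L + 0 *: N + 0 *: W1 + 0 *: W2.
  by rewrite eL !scale0r !addr0.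
have := det_frame_change F eL' eN eW1 eW2.
rewrite det_mx_of_lists => detE; rewrite {}detE in detphi.
rewrite eN eW1 eW2 !mdotE !D.
rewrite !(mulr0, mulr1, addr0, add0r).
move=> ff ef ee N2 N1 N0.
have lV : lambda * lambda^-1 = 1 by rewrite mulfV.
have cfde0 : 0 < c * f - d * e.
  move: detphi; congr (_ < _).
  by transitivity (lambda / lambda * (c * f - d * e)); [ring | rewrite lV mul1r].
have cfde1 : c * f - d * e = 1.
  (* Lagrange's identity: this square is (c^2 + d^2)(e^2 + f^2) - (c e + d f)^2. *)
  have /eqP : (c * f - d * e) ^+ 2 = 1 by nra.
  rewrite sqrf_eq1 => /orP[/eqP//|/eqP cfdeN1].
  by move: cfde0; rewrite cfdeN1; lra.
rewrite !mul0r !add0r in ff ef ee.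
have ed : e = - d.
  apply/eqP; rewrite -subr_eq0 opprK.
  have -> : e + d = e * (1 - (c * c + d * d)) + c * (c * e + d * f)
                    - d * (c * f - d * e - 1) by ring.
  by rewrite ee ef cfde1 !subrr !mulr0 !addr0 subr0.
have fc : f = c.
  apply/eqP; rewrite -subr_eq0.
  have -> : f - c = f * (1 - (c * c + d * d)) + d * (c * e + d * f)
                    + c * (c * f - d * e - 1) by ring.
  by rewrite ee ef cfde1 !subrr !mulr0 !addr0.
have [|theta [ct st]] := @exists_angle c (- d); first by rewrite -ee; ring.
exists L, N, W1, W2; split=> //.
(* The row of [N] in the matrix of a null rotation ends with [- eps] and [zeta], which must be [n1]
   and [n2]. *)
exists lambda, (- n1), n2, theta; split=> //.
rewrite eL' eN eW1 eW2 -mx_of_lists_mul; congr (_ *m _).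
(* The component of [phi N] along [N] is 1 / lambda, so each of the relations [N0], [N1], [N2] is
   solved for its [L]-component after multiplication by [lambda]. *)
have n0E : n0 = - (2^-1 * lambda * ((- n1) ^+ 2 + n2 ^+ 2)).
  apply/eqP; rewrite -subr_eq0 -[X in X - _]mul1r -lV; apply/eqP.
  by rewrite -[RHS](mulr0 (2^-1 * lambda)) -N0; field.
have a1E : a1 = lambda * (- n1) * c + lambda * n2 * (- d).
  apply/eqP; rewrite -subr_eq0; apply/eqP.
  by rewrite -[RHS](mulr0 lambda) -N1; field.
have a2E : a2 = lambda * (- n1) * (- d) - lambda * n2 * c.
  apply/eqP; rewrite -subr_eq0; apply/eqP.
  by rewrite -[RHS](mulr0 lambda) -N2 ed fc; field.
rewrite /null_rotation_mx ct st -n0E -a1E -a2E !opprK fc ed.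
by [].
Qed.

End NullRotations.

(** * Existence of a null eigenvector for isometries of positive determinant *)

Section NullEigenvectors.
Context {R : realType}.
Implicit Types (L N u v w x y k : 'rV[R]_4).

Lemma pseudo_orthonormal_swap L N (W1 W2 : 'rV[R]_4) :
  pseudo_orthonormal L N W1 W2 -> pseudo_orthonormal N L W1 W2.
Proof.
move=> F; have D := pseudo_orthonormal_dots F.
by have [] := @gram_pseudo_orthonormal R N L W1 W2; rewrite ?D.
Qed.

Lemma pseudo_orthonormal_rotate L N (W1 W2 : 'rV[R]_4) (c s : R) :
  c ^+ 2 + s ^+ 2 = 1 -> pseudo_orthonormal L N W1 W2 ->
  pseudo_orthonormal L N (c *: W1 + s *: W2) (- s *: W1 + c *: W2).
Proof.
move=> cs F; have D := pseudo_orthonormal_dots F.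
by have [] := @gram_pseudo_orthonormal R L N (c *: W1 + s *: W2)
  (- s *: W1 + c *: W2); rewrite ?mdotE ?D //;
  first [ring | rewrite -[RHS]cs; ring].
Qed.

(** Once [k] is normalized against [L], multiples of [L] make the W's orthogonal to it; as [L] is
    null and orthogonal to the W's, their other products do not change. *)
Lemma pseudo_orthonormal_complete L N (W1 W2 : 'rV[R]_4) k :
  pseudo_orthonormal L N W1 W2 -> mdot k k = 0 -> mdot k L != 0 ->
  pseudo_orthonormal L ((mdot k L)^-1 *: k)
    (W1 - (mdot k W1 / mdot k L) *: L) (W2 - (mdot k W2 / mdot k L) *: L).
Proof.
move=> F kk kL; have D := pseudo_orthonormal_dots F.
by have [] := @gram_pseudo_orthonormal R L ((mdot k L)^-1 *: k)
    (W1 - (mdot k W1 / mdot k L) *: L) (W2 - (mdot k W2 / mdot k L) *: L);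
  rewrite ?mdotE ?D ?kk ?(mdotC L k) ?(mdotC W1 k) ?(mdotC W2 k) //; field.
Qed.

(** Intermediate values on [1, r + 3]. The quartic is 4 p^2 at 1 and has leading coefficient 2 b <
    0. If p = 0 it has the factor (l - 1)^2, and the cofactor 2 b (l + 1)^2 + q^2 l is 8 b + q^2 > 0
    at 1. *)
Lemma exists_quartic_root_gt1 (b p q : R) :
  b < 0 -> p != 0 \/ - 8 * b < q ^+ 2 ->
  exists2 l : R, 1 < l &
    2 * b * (l ^+ 2 - 1) ^+ 2 +
      l * (p ^+ 2 * (l + 1) ^+ 2 + q ^+ 2 * (l - 1) ^+ 2) = 0.
Proof.
move=> b0 pq.
pose r := (p ^+ 2 + q ^+ 2) / (- (2 * b)).
have r0 : 0 <= r by rewrite divr_ge0 ?addr_ge0 ?sqr_ge0//; lra.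
have rE : p ^+ 2 + q ^+ 2 = - (2 * b) * r by rewrite /r; field; lra.
have M0 : (1 : R) <= r + 3 by lra.
have hE := (hornerN, hornerD, hornerM, hornerZ, horner_exp, hornerX, hornerC).
have [p0|p0] := eqVneq p 0.
  have q8 : - 8 * b < q ^+ 2 by case: pq => //; rewrite p0 eqxx.
  have qE : q ^+ 2 = - (2 * b) * r by rewrite -rE p0 expr0n add0r.
  have [|l] :=
      @poly_ivt R (- ((2 * b) *: ('X + 1%:P) ^+ 2 + (q ^+ 2) *: 'X)) _ _ M0.
    by rewrite !hE; apply/andP; split; [lra | rewrite qE; nra].
  move=> /andP[l1 _]; rewrite /root !hE => /eqP l2.
  exists l.
    rewrite lt_neqAle l1 andbT; apply/eqP => le1.
    by move: l2; rewrite -le1; lra.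
  have e : 2 * b * (l + 1) ^+ 2 + q ^+ 2 * l = 0 by lra.
  rewrite p0; transitivity ((l - 1) ^+ 2 * (2 * b * (l + 1) ^+ 2 + q ^+ 2 * l)).
    by ring.
  by rewrite e mulr0.
have p2 : 0 < p ^+ 2 by rewrite exprn_even_gt0.
have [|l] := @poly_ivt R (- ((2 * b) *: ('X ^+ 2 - 1%:P) ^+ 2 +
    'X * ((p ^+ 2) *: ('X + 1%:P) ^+ 2 + (q ^+ 2) *: ('X - 1%:P) ^+ 2))) _ _ M0.
  rewrite !hE; apply/andP; split; first lra.
  set m := r + 3.
  (* Replacing (m - 1)^2 by (m + 1)^2 on the left and dividing by (m + 1)^2 leaves r m <= (m - 1)^2,
     which holds for m = r + 3. *)
  suff : m * (p ^+ 2 * (m + 1) ^+ 2 + q ^+ 2 * (m - 1) ^+ 2) <=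
         - (2 * b) * (m ^+ 2 - 1) ^+ 2 by lra.
  apply: (@le_trans _ _ ((m + 1) ^+ 2 * (- (2 * b) * (r * m)))).
    have -> : (m + 1) ^+ 2 * (- (2 * b) * (r * m)) =
              (m + 1) ^+ 2 * m * (- (2 * b) * r) by ring.
    rewrite -rE -subr_ge0 [leRHS](_ : _ = (2 * m * q) ^+ 2) ?sqr_ge0//.
    by ring.
  have -> : - (2 * b) * (m ^+ 2 - 1) ^+ 2 =
         (m + 1) ^+ 2 * (- (2 * b) * (m - 1) ^+ 2) by ring.
  by rewrite ler_wpM2l ?sqr_ge0// ler_wpM2l ?oppr_ge0; rewrite /m; nra.
move=> /andP[l1 _]; rewrite /root !hE => /eqP l2.
exists l; last lra.
rewrite lt_neqAle l1 andbT; apply/eqP => le1.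
by move: l2; rewrite -le1; lra.
Qed.

Definition null_eigenvector (phi : 'rV[R]_4 -> 'rV[R]_4) :=
  exists k (l : R), [/\ k != 0, mdot k k = 0 & phi k = l *: k].

(* k = x L + N + z W1 + w W2 is an eigenvector for l if x = 1 / (b l),
   z = p / (b (l - 1)) and w = q / (b (l + 1)), and it is then null iff l is a root
   of the quartic of exists_quartic_root_gt1.  When that has no root l > 1, p = 0
   and there is a null eigenvector for l = 1, with z free. *)
Lemma null_eigenvector_reflection_neg (phi : {linear 'rV[R]_4 -> 'rV[R]_4})
    L N (W1 W2 : 'rV[R]_4) (b p q : R) :
  pseudo_orthonormal L N W1 W2 -> b < 0 ->
  phi L = b *: N ->
  phi N = b^-1 *: (L - ((p ^+ 2 + q ^+ 2) / 2) *: N + p *: W1 + q *: W2) ->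
  phi W1 = W1 - p *: N -> phi W2 = - W2 + q *: N ->
  null_eigenvector phi.
Proof.
move=> F b0 eL eN eW1 eW2; have D := pseudo_orthonormal_dots F.
have bn0 : b != 0 by rewrite lt_eqF.
have phiE (x z w : R) :
  phi (x *: L + N + z *: W1 + w *: W2) =
  b^-1 *: L + (b * x - (p ^+ 2 + q ^+ 2) / (2 * b) - p * z + q * w) *: N
  + (z + p / b) *: W1 + (q / b - w) *: W2.
  have -> : phi (x *: L + N + z *: W1 + w *: W2) =
      x *: phi L + phi N + z *: phi W1 + w *: phi W2.
    by rewrite !linearD !linearZ.
  by rewrite eL eN eW1 eW2; apply/rowP=> i; rewrite !mxE; field.
have kn0 (x z w : R) : x *: L + N + z *: W1 + w *: W2 != 0.
  apply/eqP => /(congr1 (mdot L)); rewrite !mdotE !D mdot0r => /eqP.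
  by rewrite !mulr0 add0r !addr0 oner_eq0.
have kkE (x z w : R) : mdot (x *: L + N + z *: W1 + w *: W2)
    (x *: L + N + z *: W1 + w *: W2) = 2 * x + z ^+ 2 + w ^+ 2.
  by rewrite !mdotE !D; ring.
have [[p0 q8]|pq] : (p = 0 /\ q ^+ 2 <= - 8 * b) \/ (p != 0 \/ - 8 * b < q ^+ 2).
  have [->|] := eqVneq p 0; last by right; left.
  by have [|] := leP (q ^+ 2) (- 8 * b); [left | right; right].
(* Here l = 1: [w] is forced by the eigenvalue equation and [z] is chosen to make the vector null;
   the bound on q^2 makes the radicand nonnegative. *)
- pose w := q / (2 * b); pose z := Num.sqrt (- (2 / b) - w ^+ 2).
  have z2 : z ^+ 2 = - (2 / b) - w ^+ 2.
    rewrite sqr_sqrtr// (_ : _ - _ = (- 8 * b - q ^+ 2) / (2 * b) ^+ 2).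
      by rewrite divr_ge0 ?sqr_ge0// subr_ge0.
    by rewrite /w; field.
  exists (b^-1 *: L + N + z *: W1 + w *: W2), 1; split=> //.
    by rewrite kkE z2; field.
  have nE : b / b - (0 ^+ 2 + q ^+ 2) / (2 * b) - 0 * z + q * w = 1.
    by rewrite /w; field.
  have wE : q / b - w = w by rewrite /w; field.
  by rewrite phiE p0 nE wE mul0r addr0 !scale1r.
have [l l1 lE] := exists_quartic_root_gt1 b0 pq.
have [l0 lm lp] : [/\ l != 0, l - 1 != 0 & l + 1 != 0].
  by split; rewrite gt_eqF//; lra.
pose x := (b * l)^-1; pose z := p / (b * (l - 1)); pose w := q / (b * (l + 1)).
have kk : 2 * x + z ^+ 2 + w ^+ 2 = 0.
  rewrite [LHS](_ : _ = (2 * b * (l ^+ 2 - 1) ^+ 2 +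
    l * (p ^+ 2 * (l + 1) ^+ 2 + q ^+ 2 * (l - 1) ^+ 2)) /
    (b ^+ 2 * l * (l - 1) ^+ 2 * (l + 1) ^+ 2)).
    by rewrite lE mul0r.
  by rewrite /x /z /w; field; rewrite bn0 l0 lm lp.
exists (x *: L + N + z *: W1 + w *: W2), l; split=> //.
  by rewrite kkE.
have xE : b^-1 = l * x by rewrite /x; field; rewrite ?bn0 ?l0 ?lm ?lp.
have zE : z + p / b = l * z by rewrite /z; field; rewrite ?bn0 ?l0 ?lm ?lp.
have wE : q / b - w = l * w by rewrite /w; field; rewrite ?bn0 ?l0 ?lm ?lp.
(* The equation for the [N]-component is again the quartic, up to a nonzero factor. *)
have nE : b * x - (p ^+ 2 + q ^+ 2) / (2 * b) - p * z + q * w = l.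
  apply/eqP; rewrite -subr_eq0.
  rewrite [X in X == 0](_ : _ = - (2 * b * (l ^+ 2 - 1) ^+ 2 +
    l * (p ^+ 2 * (l + 1) ^+ 2 + q ^+ 2 * (l - 1) ^+ 2)) /
    (2 * b * l * (l - 1) * (l + 1))).
    by rewrite lE oppr0 mul0r.
  by rewrite /x /z /w; field; rewrite bn0 l0 lm lp.
by rewrite phiE nE zE wE xE !scalerDr !scalerA.
Qed.

(** For b > 0 pass to [- phi], which has the same eigenvectors: [b] changes sign and the roles of
    [W1], [p] and [W2], [q] are exchanged. *)
Lemma null_eigenvector_reflection (phi : {linear 'rV[R]_4 -> 'rV[R]_4})
    L N (W1 W2 : 'rV[R]_4) (b p q : R) :
  pseudo_orthonormal L N W1 W2 -> b != 0 ->
  phi L = b *: N ->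
  phi N = b^-1 *: (L - ((p ^+ 2 + q ^+ 2) / 2) *: N + p *: W1 + q *: W2) ->
  phi W1 = W1 - p *: N -> phi W2 = - W2 + q *: N ->
  null_eigenvector phi.
Proof.
move=> F; rewrite neq_lt => /orP[b0|b0] eL eN eW1 eW2.
  exact: null_eigenvector_reflection_neg F b0 eL eN eW1 eW2.
have F' : pseudo_orthonormal L N W2 W1.
  have D := pseudo_orthonormal_dots F.
  by have [] := @gram_pseudo_orthonormal R L N W2 W1; rewrite ?D.
have [|||||k [l [k0 kk kl]]] :=
    @null_eigenvector_reflection_neg (\- phi) _ _ _ _ (- b) q p F' _ _ _ _ _.
- by rewrite oppr_lt0.
- by rewrite /= eL scaleNr.
- rewrite /= eN invrN scaleNr; congr (- (_ *: _)).
  by rewrite addrAC [p ^+ 2 + _]addrC.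
- by rewrite /= eW2 opprD opprK.
- by rewrite /= eW1 opprB addrC.
- by exists k, (- l); split=> //; rewrite scaleNr -kl opprK.
Qed.

(* After completing L and phi L to a frame, phi acts on the W-plane modulo phi L as
   a reflection of angle theta, which rotating W1, W2 by theta / 2 diagonalizes. *)
Lemma null_eigenvector_proper (phi : {linear 'rV[R]_4 -> 'rV[R]_4})
    L N (W1 W2 : 'rV[R]_4) :
  pseudo_orthonormal L N W1 W2 -> isometric phi -> 0 < \det (lin1_mx phi) ->
  null_eigenvector phi.
Proof.
move=> F0 iso detphi; have D0 := pseudo_orthonormal_dots F0.
have phiLL : mdot (phi L) (phi L) = 0 by rewrite iso D0.
(* If the null vector [phi L] is orthogonal to [L] it is a multiple of [L], which is then the
   eigenvector. *)
have [b0|b0] := eqVneq (mdot (phi L) L) 0.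
  have eL := frame_expansion (phi L) F0.
  move: eL; rewrite b0 scale0r addr0.
  move: (mdot _ N) (mdot _ W1) (mdot _ W2) => n c d eL.
  move: phiLL; rewrite eL !mdotE !D0 => cd.
  have [c0 d0] : c = 0 /\ d = 0.
    by split; apply/eqP; rewrite -sqrf_eq0 eq_le sqr_ge0 andbT; nra.
  exists L, n; rewrite D0 eL c0 d0 !scale0r !addr0; split=> //.
  apply/eqP => L0; have : mdot L N = 1 by rewrite D0.
  by rewrite L0 mdot0l => /eqP; rewrite eq_sym oner_eq0.
have F := pseudo_orthonormal_complete F0 phiLL b0.
set b := mdot (phi L) L in b0 F; set M := b^-1 *: phi L in F.
move: F; move: (W1 - _) (W2 - _) => {F0 D0}{}W1 {}W2 F.
have eL : phi L = b *: M by rewrite scalerA mulfV// scale1r.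
have {N}[N eM] : exists N, N = M by exists M.
rewrite -eM in eL F; clear M eM.
have dotN x : mdot (phi x) N = b^-1 * mdot x L.
  by rewrite -(iso x L) eL mdotZr mulKf.
have [V1 [V2 {F}F [r1 [r2 [eV1 eV2]]]]] : exists V1, exists2 V2,
    pseudo_orthonormal L N V1 V2 & exists r1 r2,
    phi V1 = V1 + r1 *: N /\ phi V2 = - V2 + r2 *: N.
  have D := pseudo_orthonormal_dots F.
  have eN := frame_expansion (phi N) F.
  have eW1 := frame_expansion (phi W1) F.
  have eW2 := frame_expansion (phi W2) F.
  have eL' : phi L = 0 *: L + b *: N + 0 *: W1 + 0 *: W2.
    by rewrite eL !scale0r add0r !addr0.
  rewrite !dotN !D mulr0 ?mulr1 in eN eW1 eW2.
  have := iso W1 W1; have := iso W1 W2; have := iso W2 W2.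
  move: eN eW1 eW2; move: (mdot (phi N) L) (mdot (phi N) W1) (mdot (phi N) W2).
  move: (mdot (phi W1) L) (mdot (phi W1) W1) (mdot (phi W1) W2) => r1 c d.
  move: (mdot (phi W2) L) (mdot (phi W2) W1) (mdot (phi W2) W2) => r2 e f.
  move=> n p q eN eW1 eW2.
  move: detphi; rewrite (det_frame_change F eL' eN eW1 eW2) det_mx_of_lists.
  rewrite eW1 eW2 !mdotE !D => detphi ff ef ee.
  (* Modulo lower terms [phi] exchanges the lines of [L] and [N], which contributes the factor -1 to
     its determinant. *)
  have cfde0 : c * f - d * e < 0.
    rewrite -oppr_gt0; move: detphi; congr (_ < _).
    transitivity (- (b / b) * (c * f - d * e)); first by ring.
    by rewrite mulfV// mulN1r.
  rewrite !(mul0r, mulr0, mulr1, add0r, addr0) in ff ef ee.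
  have cfdeN1 : c * f - d * e = -1.
    have /eqP : (c * f - d * e) ^+ 2 = 1 by nra.
    rewrite sqrf_eq1 => /orP[/eqP cfde1|/eqP//].
    by move: cfde0; rewrite cfde1; lra.
  have ed : e = d.
    apply/eqP; rewrite -subr_eq0.
    have -> : e - d = e * (1 - (c * c + d * d)) + c * (c * e + d * f)
                      - d * (c * f - d * e + 1) by ring.
    by rewrite ee ef cfdeN1 subrr addNr !mulr0 !addr0 subr0.
  have fc : f = - c.
    apply/eqP; rewrite -subr_eq0 opprK.
    have -> : f + c = f * (1 - (c * c + d * d)) + d * (c * e + d * f)
                      + c * (c * f - d * e + 1) by ring.
    by rewrite ee ef cfdeN1 subrr addNr !mulr0 !addr0.
  have [|theta [ct st]] := @exists_angle R c d; first by rewrite -ee; ring.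
  pose c' := cos (theta / 2); pose s' := sin (theta / 2).
  have cs : c' ^+ 2 + s' ^+ 2 = 1 by exact: cos2Dsin2.
  have thE : theta = theta / 2 + theta / 2 by field.
  have cE : c = c' ^+ 2 - s' ^+ 2 by rewrite -ct thE cosD.
  have dE : d = 2 * c' * s' by rewrite -st {1}thE sinD -/c' -/s'; ring.
  exists (c' *: W1 + s' *: W2), (- s' *: W1 + c' *: W2).
    exact: pseudo_orthonormal_rotate.
  exists (c' * r1 + s' * r2), (- s' * r1 + c' * r2).
  have phiE (x y : R) : phi (x *: W1 + y *: W2) = x *: phi W1 + y *: phi W2.
    by rewrite linearD !linearZ.
  rewrite !phiE eW1 eW2 ed fc.
  (* The direction of angle theta / 2 is the axis of the reflection, hence fixed by it. *)
  have c1 : c' = c' * c + s' * d.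
    by rewrite -[LHS]mulr1 -cs cE dE; ring.
  have s1 : s' = c' * d - s' * c.
    by rewrite -[LHS]mulr1 -cs cE dE; ring.
  split; apply/rowP=> i; rewrite !mxE.
    transitivity ((c' * c + s' * d) * W1 0 i + (c' * d - s' * c) * W2 0 i +
                  (c' * r1 + s' * r2) * N 0 i); first by ring.
    by rewrite -c1 -s1.
  transitivity (- (- (c' * d - s' * c) * W1 0 i + (c' * c + s' * d) * W2 0 i) +
                (- s' * r1 + c' * r2) * N 0 i); first by ring.
  by rewrite -c1 -s1.
have D := pseudo_orthonormal_dots F.
have eN := frame_expansion (phi N) F.
rewrite dotN !D mulr1 in eN.
have := iso N N; have := iso N V1; have := iso N V2; rewrite !D.
move: eN; move: (mdot _ L) (mdot _ V1) (mdot _ V2) => n p q eN.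
rewrite eV1 eV2 eN !mdotE !D => qE pE nE.
have {}nE : n = - (b * (p ^+ 2 + q ^+ 2) / 2).
  apply/eqP; rewrite -subr_eq0; apply/eqP.
  by rewrite -[RHS](mulr0 (b / 2)) -nE; field.
have r1E : r1 = - (b * p).
  apply/eqP; rewrite -subr_eq0; apply/eqP.
  by rewrite -[RHS](mulr0 b) -pE; field.
have r2E : r2 = b * q.
  apply/eqP; rewrite -subr_eq0; apply/eqP.
  by rewrite -[RHS](mulr0 b) -qE; field.
apply: (@null_eigenvector_reflection phi L N V1 V2 b (b * p) (b * q)) => //.
- by rewrite eN nE; apply/rowP=> i; rewrite !mxE; field.
- by rewrite eV1 r1E scaleNr.
- by rewrite eV2 r2E.
Qed.

(** A null vector orthogonal to both [L] and [N] lies in the space-like W-plane and vanishes. So the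
    null eigenvector can be completed to a frame with [L] or with [N], and a swap puts it first. *)
Lemma proper_isometry_null_rotation (phi : {linear 'rV[R]_4 -> 'rV[R]_4})
    L N (W1 W2 : 'rV[R]_4) :
  pseudo_orthonormal L N W1 W2 -> isometric phi -> 0 < \det (lin1_mx phi) ->
  null_rotation phi.
Proof.
move=> F iso detphi.
have [k [l [k0 kk kl]]] := null_eigenvector_proper F iso detphi.
have l0 : l != 0.
  apply: contraNneq k0 => l0; rewrite l0 scale0r in kl.
  have dot0 x : mdot k x = 0 by rewrite -iso kl mdot0l.
  by rewrite (frame_expansion k F) !dot0 !scale0r !addr0.
have eigen_scale (a : R) : phi (a *: k) = l *: (a *: k).
  by rewrite linearZ /= kl scalerA mulrC -scalerA.
have [kL|kL] := eqVneq (mdot k L) 0; last first.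
  have F' := pseudo_orthonormal_swap (pseudo_orthonormal_complete F kk kL).
  exact: null_rotation_of_null_eigenvector F' iso detphi l0 (eigen_scale _).
have kE := frame_expansion k F; have D := pseudo_orthonormal_dots F.
rewrite kL scale0r addr0 in kE.
have kN : mdot k N != 0.
  apply: contraNneq k0 => kN; rewrite kN scale0r add0r in kE.
  move: kk kE; move: (mdot k W1) (mdot k W2) => c d kk kE.
  move: kk; rewrite kE !mdotE !D => cd.
  have [-> ->] : c = 0 /\ d = 0.
    by split; apply/eqP; rewrite -sqrf_eq0 eq_le sqr_ge0 andbT; nra.
  by rewrite !scale0r addr0.
have F' := pseudo_orthonormal_swap
  (pseudo_orthonormal_complete (pseudo_orthonormal_swap F) kk kN).
exact: null_rotation_of_null_eigenvector F' iso detphi l0 (eigen_scale _).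
Qed.

End NullEigenvectors.

(** * Differentiation of vector fields and of their inner products *)

Section DerivativesOfVectorFields.
Context {R : realType}.
Implicit Types (X Y : R -> 'rV[R]_4) (I : set R).

Lemma is_derive_mxP {m n : nat} (X : R -> 'M[R]_(m, n)) (t : R) dX :
  is_derive t 1 X dX <-> forall i j, is_derive t 1 (fun s => X s i j) (dX i j).
Proof.
split=> [XdX i j|XdX].
  have dvX : derivable X t 1 by case: XdX.
  apply: DeriveDef; first by move/derivable_mxP : dvX.
  by case: XdX => _ <-; rewrite derive_mx// mxE.
have dvX : derivable X t 1.
  by apply/derivable_mxP => i j; case: (XdX i j).
apply: DeriveDef => //; rewrite derive_mx//; apply/matrixP=> i j.
by rewrite mxE; case: (XdX i j).
Qed.

Lemma is_derive_mdot X Y (t : R) dX dY :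
  is_derive t 1 X dX -> is_derive t 1 Y dY ->
  is_derive t 1 (fun s => mdot (X s) (Y s)) (mdot dX (Y t) + mdot (X t) dY).
Proof.
move=> /is_derive_mxP dX_ /is_derive_mxP dY_.
have dM i : is_derive t 1 (fun s => X s 0 i * Y s 0 i)
    (X t 0 i * dY 0 i + Y t 0 i * dX 0 i).
  exact: (is_deriveM (dX_ 0 i) (dY_ 0 i)).
have := is_deriveD (is_deriveD (is_deriveD (is_deriveN (dM 0)) (dM 1)) (dM 2))
  (dM 3).
by move/is_derive_eq; apply; rewrite /mdot; ring.
Qed.

Lemma is_derive_scale (a : R -> R) X (t : R) da dX :
  is_derive t 1 a da -> is_derive t 1 X dX ->
  is_derive t 1 (fun s => a s *: X s) (da *: X t + a t *: dX).
Proof.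
move=> a_ /is_derive_mxP X_; apply/is_derive_mxP => i j.
rewrite (_ : (fun s => _) = a * (fun s => X s i j)); last first.
  by apply/funext=> s; rewrite mxE.
apply: (is_derive_eq (is_deriveM a_ (X_ i j))).
by rewrite !mxE /GRing.scale /=; ring.
Qed.

Lemma derive_mdot_cst I X Y (t c : R) dX dY :
  open I -> I t -> (forall s, I s -> mdot (X s) (Y s) = c) ->
  is_derive t 1 X dX -> is_derive t 1 Y dY -> mdot dX (Y t) + mdot (X t) dY = 0.
Proof.
move=> oI It XY dX_ dY_.
have [_ <-] := is_derive_mdot dX_ dY_.
rewrite -[RHS](derive_cst c t 1); apply: near_eq_derive.
by near=> s; apply: XY; near: s; exact: open_nbhs_nbhs.
Unshelve. all: by end_near. Qed.

Lemma eq_of_derive0 I (f : R -> R) :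
  is_interval I -> (forall t, I t -> is_derive t 1 f 0) ->
  forall s t, I s -> I t -> f s = f t.
Proof.
move=> itvI f0 s t; wlog: s t / s <= t.
  by move=> H Is It; case: (leP s t) => [/H|/ltW /H]; [apply | move->].
move=> st Is It.
have sub u : u \in `[s, t]%R -> I u by rewrite in_itv /=; exact: itvI.
have [||u _] := @MVT_segment R f (fun=> 0) s t st.
- by move=> u /subset_itv_oo_cc /sub /f0.
- by apply: derivable_within_continuous => u /sub /f0 [].
- by rewrite mul0r => /eqP; rewrite subr_eq0 => /eqP.
Qed.

Lemma eq_of_derive0_rV I X :
  is_interval I -> (forall t, I t -> is_derive t 1 X 0) ->
  forall s t, I s -> I t -> X s = X t.
Proof.
move=> itvI X0 s t Is It; apply/rowP=> i.
apply: (eq_of_derive0 itvI _ Is It (f := fun s => X s 0 i)) => u Iu.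
by have /is_derive_mxP /(_ 0 i) := X0 _ Iu; rewrite mxE.
Qed.

End DerivativesOfVectorFields.

(** * Frenet equations and pseudo-arc speed in the pseudo-de Sitter parameter *)

Section CartanFrames.
Context {R : realType} (I : set R) (c : R -> 'rV[R]_4) (F : frame_field R).
Hypothesis oI : open I.
Hypothesis cartan_c : cartan_curve I c.
Hypothesis frame_F : cartan_frame I c F.
Hypothesis param_F : de_sitter_parametrized I F.

Local Notation v := (pseudo_arc_speed c).
Local Notation L := (frL F).
Local Notation N := (frN F).
Local Notation W1 := (frW1 F).
Local Notation W2 := (frW2 F).

Lemma is_derive_smooth (X : R -> 'rV[R]_4) n t :
  smooth_on I X -> I t -> is_derive t 1 (derive1n n X) (derive1n n.+1 X t).
Proof.
by move=> sX It; apply: DeriveDef; [exact: sX | rewrite derive1nS derive1E].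
Qed.

Lemma smooth_curve : smooth_on I c.
Proof. by case: cartan_c => -[]. Qed.

Lemma pseudo_arc_speed_gt0 t : I t -> 0 < v t.
Proof.
move=> It; have [_ /(_ _ It)[c2 _]] := cartan_c.
(* A real power of a nonzero base is positive by the convention of [powR], whatever the sign of the
   base. *)
by rewrite lt0r powR_ge0 powR_eq0 negb_and c2.
Qed.

Lemma cartan_frame_pseudo_orthonormal t :
  I t -> pseudo_orthonormal (L t) (N t) (W1 t) (W2 t).
Proof. by case: frame_F => _ + _ _ _; exact. Qed.

Lemma arc_deriveE (X : R -> 'rV[R]_4) Y t : I t -> arc_derive c X t = Y ->
  derive1 X t = v t *: Y.
Proof.
move=> It <-; rewrite /arc_derive scalerA mulfV ?scale1r//.
by rewrite gt_eqF// pseudo_arc_speed_gt0.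
Qed.

Lemma is_derive_curve t : I t -> is_derive t 1 c (v t *: L t).
Proof.
move=> It; case: frame_F => _ _ _ _ /(_ _ It)[+ _ _ _ _] => /(arc_deriveE It) <-.
exact: (is_derive_smooth 0 smooth_curve).
Qed.

Lemma is_derive_frL t : I t -> is_derive t 1 L (v t *: W1 t).
Proof.
move=> It; case: frame_F => -[sX _ _ _] _ _ _ /(_ _ It)[_ + _ _ _].
by move=> /(arc_deriveE It) <-; exact: (is_derive_smooth 0 sX).
Qed.

Lemma is_derive_frN t : I t ->
  is_derive t 1 N (v t *: (kappa F t *: W1 t + tau F t *: W2 t)).
Proof.
move=> It; case: frame_F => -[_ sX _ _] _ _ _ /(_ _ It)[_ _ + _ _].
by move=> /(arc_deriveE It) <-; exact: (is_derive_smooth 0 sX).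
Qed.

Lemma is_derive_frW1 t : I t ->
  is_derive t 1 W1 (v t *: (- (kappa F t *: L t) - N t)).
Proof.
move=> It; case: frame_F => -[_ _ sX _] _ _ _ /(_ _ It)[_ _ _ + _].
by move=> /(arc_deriveE It) <-; exact: (is_derive_smooth 0 sX).
Qed.

Lemma is_derive_frW2 t : I t -> is_derive t 1 W2 (v t *: - (tau F t *: L t)).
Proof.
move=> It; case: frame_F => -[_ _ _ sX] _ _ _ /(_ _ It)[_ _ _ _ +].
by move=> /(arc_deriveE It) <-; exact: (is_derive_smooth 0 sX).
Qed.

Lemma derive1_curve t : I t -> derive1n 1 c t = v t *: L t.
Proof. by move=> It; rewrite derive1n1 derive1E; case: (is_derive_curve It). Qed.

(** Differentiating the vanishing product shifts a derivative from [X] to [Y]. With frame vectors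
    for [Y] this yields the components of higher derivatives of a curve from the Frenet
    equations. *)
Lemma mdot_derive1n (n : nat) (X : R -> 'rV[R]_4) Y t dY :
  smooth_on I X -> I t -> (forall s, I s -> mdot (derive1n n X s) (Y s) = 0) ->
  is_derive t 1 Y dY ->
  mdot (derive1n n.+1 X t) (Y t) = - mdot (derive1n n X t) dY.
Proof.
move=> sX It XY dY_; apply/eqP; rewrite -subr_eq0 opprK; apply/eqP.
exact: derive_mdot_cst oI It XY (is_derive_smooth n sX It) dY_.
Qed.

Lemma tau_lt0 t : I t -> tau F t < 0.
Proof.
(* The matrix of the first four derivatives in the frame is triangular up to
   swapping N and W1, and its determinant is - v^10 tau. *)
have D s (Is : I s) :=
  pseudo_orthonormal_dots (cartan_frame_pseudo_orthonormal Is).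
have c1L s : I s -> mdot (derive1n 1 c s) (L s) = 0.
  by move=> Is; rewrite derive1_curve// mdotZl !(D s Is) mulr0.
have c1W1 s : I s -> mdot (derive1n 1 c s) (W1 s) = 0.
  by move=> Is; rewrite derive1_curve// mdotZl !(D s Is) mulr0.
have c1W2 s : I s -> mdot (derive1n 1 c s) (W2 s) = 0.
  by move=> Is; rewrite derive1_curve// mdotZl !(D s Is) mulr0.
have c2L s : I s -> mdot (derive1n 2 c s) (L s) = 0.
  move=> Is; rewrite (mdot_derive1n smooth_curve Is c1L (is_derive_frL Is)).
  by rewrite mdotZr c1W1// mulr0 oppr0.
have c2W1 s : I s -> mdot (derive1n 2 c s) (W1 s) = v s ^+ 2.
  move=> Is; rewrite (mdot_derive1n smooth_curve Is c1W1 (is_derive_frW1 Is)).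
  by rewrite !mdotE c1L// derive1_curve// mdotE !(D s Is); ring.
have c2W2 s : I s -> mdot (derive1n 2 c s) (W2 s) = 0.
  move=> Is; rewrite (mdot_derive1n smooth_curve Is c1W2 (is_derive_frW2 Is)).
  by rewrite !mdotE c1L// !mulr0 oppr0 mulr0 oppr0.
have c3L s : I s -> mdot (derive1n 3 c s) (L s) = - v s ^+ 3.
  move=> Is; rewrite (mdot_derive1n smooth_curve Is c2L (is_derive_frL Is)).
  by rewrite mdotZr c2W1//; ring.
have c3W2 s : I s -> mdot (derive1n 3 c s) (W2 s) = 0.
  move=> Is; rewrite (mdot_derive1n smooth_curve Is c2W2 (is_derive_frW2 Is)).
  by rewrite !mdotE c2L// !mulr0 oppr0 mulr0 oppr0.
have c4W2 s : I s -> mdot (derive1n 4 c s) (W2 s) = - v s ^+ 4 * tau F s.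
  move=> Is; rewrite (mdot_derive1n smooth_curve Is c3W2 (is_derive_frW2 Is)).
  by rewrite !mdotE c3L//; ring.
move=> It.
have detM b0 c0 c2 d0 d1 d2 : \det (mx_of_lists
    [:: [:: v t; 0; 0; 0]; [:: b0; 0; v t ^+ 2; 0];
        [:: c0; - v t ^+ 3; c2; 0]; [:: d0; d1; d2; - v t ^+ 4 * tau F t]]) =
    v t ^+ 10 * - tau F t.
  by rewrite det_mx_of_lists; ring.
have Ft := cartan_frame_pseudo_orthonormal It.
have v0 := pseudo_arc_speed_gt0 It.
have e1 := frame_expansion (derive1n 1 c t) Ft.
have e2 := frame_expansion (derive1n 2 c t) Ft.
have e3 := frame_expansion (derive1n 3 c t) Ft.
have e4 := frame_expansion (derive1n 4 c t) Ft.
rewrite c1L// c1W1// c1W2// in e1; rewrite c2L// c2W1// c2W2// in e2.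
rewrite c3L// c3W2// in e3; rewrite c4W2// in e4.
have c1N : mdot (derive1n 1 c t) (N t) = v t.
  by rewrite derive1_curve// mdotZl !(D t It) mulr1.
rewrite c1N in e1.
case: frame_F => _ _ /(_ _ It) detF /(_ _ It) + _; rewrite /same_orientation.
rewrite pmulr_rgt0// /derivatives_mx -derive1n1 e1 e2 e3 e4 -mx_of_lists_mul.
rewrite det_mulmx pmulr_lgt0// detM.
by rewrite pmulr_rgt0 ?exprn_gt0// oppr_gt0.
Qed.

(** The second derivative of [W2] is orthogonal to [L] and [W2] and has [W1]-component - v^2 tau, so
    its square is (v^2 tau)^2. Unit de Sitter speed makes this 1, and tau < 0 gives the sign. *)
Lemma pseudo_arc_speed_tau t : I t -> v t ^+ 2 * tau F t = -1.
Proof.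
have D s (Is : I s) :=
  pseudo_orthonormal_dots (cartan_frame_pseudo_orthonormal Is).
have sW2 : smooth_on I W2 by case: frame_F => -[].
have eW s : I s -> derive1n 1 W2 s = v s *: - (tau F s *: L s).
  by move=> Is; rewrite derive1n1 derive1E; case: (is_derive_frW2 Is).
have w1L s : I s -> mdot (derive1n 1 W2 s) (L s) = 0.
  by move=> Is; rewrite eW// !mdotE !(D s Is); ring.
have w1W1 s : I s -> mdot (derive1n 1 W2 s) (W1 s) = 0.
  by move=> Is; rewrite eW// !mdotE !(D s Is); ring.
have w1W2 s : I s -> mdot (derive1n 1 W2 s) (W2 s) = 0.
  by move=> Is; rewrite eW// !mdotE !(D s Is); ring.
move=> It; have Ft := cartan_frame_pseudo_orthonormal It.
have w2L : mdot (derive1n 2 W2 t) (L t) = 0.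
  rewrite (mdot_derive1n sW2 It w1L (is_derive_frL It)).
  by rewrite !mdotE w1W1//; ring.
have w2W2 : mdot (derive1n 2 W2 t) (W2 t) = 0.
  rewrite (mdot_derive1n sW2 It w1W2 (is_derive_frW2 It)).
  by rewrite !mdotE w1L//; ring.
have w2W1 : mdot (derive1n 2 W2 t) (W1 t) = - (v t ^+ 2 * tau F t).
  rewrite (mdot_derive1n sW2 It w1W1 (is_derive_frW1 It)).
  by rewrite eW// !mdotE !(D t It); ring.
have w2w2 : mdot (derive1n 2 W2 t) (derive1n 2 W2 t) = (v t ^+ 2 * tau F t) ^+ 2.
  rewrite (frame_expansion (derive1n 2 W2 t) Ft) w2L w2W1 w2W2 !mdotE !(D t It).
  by ring.
have p1 : ((v t ^+ 2 * tau F t) ^+ 2) `^ 4^-1 = 1.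
  by rewrite -w2w2; exact: param_F.
have : (v t ^+ 2 * tau F t) ^+ 2 = 1.
  have := congr1 (fun x => x ^+ 4) p1; rewrite expr1n -powR_mulrn ?powR_ge0//.
  by rewrite -powRrM mulVf// powRr1 ?sqr_ge0.
move=> /eqP; rewrite sqrf_eq1 => /orP[/eqP e|/eqP//].
have : v t ^+ 2 * tau F t < 0.
  by rewrite nmulr_llt0 ?tau_lt0// exprn_gt0// pseudo_arc_speed_gt0.
by rewrite e; lra.
Qed.

(** On [I] the speed is the inner product of c' = v L with [N], both smooth. *)
Lemma derivable_pseudo_arc_speed t : I t -> derivable v t 1.
Proof.
move=> It; have dN := is_derive_frN It.
have [+ _] := is_derive_mdot (is_derive_smooth 1 smooth_curve It) dN.
apply: near_eq_derivable; near=> s.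
have Is : I s by near: s; exact: open_nbhs_nbhs.
rewrite derive1_curve// mdotZl.
by rewrite (pseudo_orthonormal_dots (cartan_frame_pseudo_orthonormal Is)) mulr1.
Unshelve. all: by end_near. Qed.

(** Logarithmic derivative of tau = - 1 / v^2, which holds on a neighbourhood of [t]. *)
Lemma shape_tau_pseudo_arc_speed t : I t -> shape_tau F t = derive1 v t / v t.
Proof.
move=> It; have v0 := pseudo_arc_speed_gt0 It.
have tauE s : I s -> tau F s = - (v s ^+ 2)^-1.
  move=> Is; have vs := pseudo_arc_speed_gt0 Is.
  apply: (mulfI (lt0r_neq0 (exprn_gt0 2 vs))).
  by rewrite pseudo_arc_speed_tau// mulrN mulfV// expf_neq0// gt_eqF.
have dv : is_derive t 1 v (derive1 v t).
  by rewrite derive1E; apply: derivableP; exact: derivable_pseudo_arc_speed.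
have v2 : (v * v) t != 0.
  by rewrite (_ : (v * v) t = v t * v t)// mulf_neq0 ?gt_eqF.
have dtau := is_deriveN (is_deriveV v2 (is_deriveM dv dv)).
have {dtau}[_ dtau] : is_derive t 1 (tau F) (2 * derive1 v t / v t ^+ 3).
  apply: near_eq_is_derive (is_derive_eq dtau _).
    near=> s; rewrite tauE//; near: s; exact: open_nbhs_nbhs.
  rewrite (_ : (v * v) t = v t * v t)// /GRing.scale /=; field.
  by rewrite gt_eqF.
rewrite /shape_tau derive1E dtau param_F// tauE//; field.
by rewrite gt_eqF.
Unshelve. all: by end_near. Qed.

(** Presents the speed as a solution [u] of the linear equation u' = shape_tau u, which determines
    it up to a constant factor, together with the Frenet system in the parameter sigma. *)
Lemma cartan_frame_speed : exists u : R -> R,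
  (forall t, I t -> [/\ 0 < u t, u t ^+ 2 * tau F t = -1, tau F t < 0,
     is_derive t 1 u (shape_tau F t * u t) & is_derive t 1 c (u t *: L t)]) /\
  forall t, I t ->
    [/\ is_derive t 1 L (u t *: W1 t),
        is_derive t 1 N (u t *: (kappa F t *: W1 t + tau F t *: W2 t)),
        is_derive t 1 W1 (u t *: (- (kappa F t *: L t) - N t)) &
        is_derive t 1 W2 (u t *: - (tau F t *: L t))].
Proof.
exists v; split=> t It; split.
- exact: pseudo_arc_speed_gt0.
- exact: pseudo_arc_speed_tau.
- exact: tau_lt0.
- have eq_mul (x y z : R) : 0 < y -> x = z / y -> z = x * y.
    by move=> y0 ->; rewrite divfK ?gt_eqF.
  have vt := pseudo_arc_speed_gt0 It.
  rewrite -(eq_mul _ _ _ vt (shape_tau_pseudo_arc_speed It)) derive1E.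
  exact/derivableP/derivable_pseudo_arc_speed.
- exact: is_derive_curve.
- exact: is_derive_frL.
- exact: is_derive_frN.
- exact: is_derive_frW1.
- exact: is_derive_frW2.
Qed.

End CartanFrames.

(** * The linear map carrying one moving frame to another *)

Section FrameMap.
Context {R : realType}.

(** The coefficients are those of [frame_expansion]; the formula is linear in [x] for arbitrary
    vectors and can be differentiated along frames. *)
Definition frame_map (L N W1 W2 L' N' W1' W2' x : 'rV[R]_4) : 'rV[R]_4 :=
  mdot x N *: L' + mdot x L *: N' + mdot x W1 *: W1' + mdot x W2 *: W2'.

Section Linearity.
Context (L N W1 W2 L' N' W1' W2' : 'rV[R]_4).
Local Notation phi := (frame_map L N W1 W2 L' N' W1' W2').

Lemma frame_map_linear : linear phi.
Proof.
by move=> a x y; rewrite /frame_map !mdotE; apply/rowP=> i; rewrite !mxE; ring.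
Qed.

HB.instance Definition _ :=
  GRing.isLinear.Build R 'rV[R]_4 'rV[R]_4 *:%R phi frame_map_linear.

Hypothesis F : pseudo_orthonormal L N W1 W2.

Lemma frame_map_frame :
  [/\ phi L = L', phi N = N', phi W1 = W1' & phi W2 = W2'].
Proof.
have D := pseudo_orthonormal_dots F.
by split; rewrite /frame_map !D !scale0r scale1r ?add0r ?addr0.
Qed.

Hypothesis F' : pseudo_orthonormal L' N' W1' W2'.

Lemma frame_map_isometric : isometric phi.
Proof.
move=> x y; rewrite [in RHS](frame_expansion x F) [in RHS](frame_expansion y F).
rewrite /frame_map !mdotE !(pseudo_orthonormal_dots F).
by rewrite !(pseudo_orthonormal_dots F').
Qed.

Lemma det_frame_map_gt0 :
  0 < \det (mx_of_rows L N W1 W2) -> 0 < \det (mx_of_rows L' N' W1' W2') ->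
  0 < \det (lin1_mx phi).
Proof.
have -> : mx_of_rows L' N' W1' W2' = mx_of_rows L N W1 W2 *m lin1_mx phi.
  have [eL eN eW1 eW2] := frame_map_frame.
  by rewrite -mx_of_rows_linear /= eL eN eW1 eW2.
by move=> detF; rewrite det_mulmx pmulr_rgt0.
Qed.

End Linearity.

(** The coefficient matrix of the Frenet system is skew for the Gram pairing that exchanges [L] and
    [N], so the terms of the derivative cancel in pairs. *)
Lemma frame_map_constant (I : set R) (v k t : R -> R)
    (L N W1 W2 L' N' W1' W2' : R -> 'rV[R]_4) :
  is_interval I ->
  (forall s, I s ->
    [/\ is_derive s 1 L (v s *: W1 s),
        is_derive s 1 N (v s *: (k s *: W1 s + t s *: W2 s)),
        is_derive s 1 W1 (v s *: (- (k s *: L s) - N s)) &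
        is_derive s 1 W2 (v s *: - (t s *: L s))]) ->
  (forall s, I s ->
    [/\ is_derive s 1 L' (v s *: W1' s),
        is_derive s 1 N' (v s *: (k s *: W1' s + t s *: W2' s)),
        is_derive s 1 W1' (v s *: (- (k s *: L' s) - N' s)) &
        is_derive s 1 W2' (v s *: - (t s *: L' s))]) ->
  forall s0 s x, I s0 -> I s ->
    frame_map (L s0) (N s0) (W1 s0) (W2 s0) (L' s0) (N' s0) (W1' s0) (W2' s0) x =
    frame_map (L s) (N s) (W1 s) (W2 s) (L' s) (N' s) (W1' s) (W2' s) x.
Proof.
move=> itvI dF dF' s0 s x I0 Is.
pose X s := frame_map (L s) (N s) (W1 s) (W2 s) (L' s) (N' s) (W1' s) (W2' s) x.
apply: (eq_of_derive0_rV (X := X) itvI _ I0 Is) => u Iu.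
have [dL dN dW1 dW2] := dF u Iu; have [dL' dN' dW1' dW2'] := dF' u Iu.
have dx (Y Z : R -> 'rV[R]_4) (dY dZ : 'rV[R]_4) :
    is_derive u 1 Y dY -> is_derive u 1 Z dZ ->
    is_derive u 1 (fun s => mdot x (Y s) *: Z s)
      (mdot x dY *: Z u + mdot x (Y u) *: dZ).
  move=> dY_ dZ_.
  have dx_ : is_derive u 1 (fun=> x) (0 : 'rV[R]_4) by exact: is_derive_cst.
  have dxY := is_derive_mdot dx_ dY_; rewrite mdot0l add0r in dxY.
  exact: is_derive_scale dxY dZ_.
have := is_deriveD (is_deriveD (is_deriveD (dx _ _ _ _ dN dL')
  (dx _ _ _ _ dL dN')) (dx _ _ _ _ dW1 dW1')) (dx _ _ _ _ dW2 dW2').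
move/is_derive_eq; apply; rewrite !mdotE.
by apply/rowP=> i; rewrite !mxE; ring.
Qed.

(** Serves for empty [I], where the curves supply no frame; an explicit one is built from two null
    vectors in the plane of the coordinates 0 and 3. *)
Lemma p_similarity_id : p_similarity (@id 'rV[R]_4).
Proof.
pose r (s : seq R) : 'rV[R]_4 := \row_(j < 4) nth 0 s j.
have rE s s' : mdot (r s) (r s') =
    - (nth 0 s 0 * nth 0 s' 0) + nth 0 s 1 * nth 0 s' 1 +
    nth 0 s 2 * nth 0 s' 2 + nth 0 s 3 * nth 0 s' 3.
  by rewrite /mdot !mxE.
have [||||||||||F _] := @gram_pseudo_orthonormal R (r [:: 1; 0; 0; 1])
  (r [:: - 2^-1; 0; 0; 2^-1]) (r [:: 0; 1; 0; 0]) (r [:: 0; 0; 1; 0]);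
  try by rewrite rE /=; field.
exists 1, idfun, 0; split; rewrite ?oner_neq0//.
  apply: proper_isometry_null_rotation F _ _ => //.
  rewrite (_ : lin1_mx idfun = 1%:M) ?det1//.
  by apply/row_matrixP=> i; rewrite rowE mul_rV_lin1 row1.
by move=> x; rewrite scale1r addr0.
Qed.

End FrameMap.

(** * Construction of the p-similarity from the two Cartan frames *)

Theorem theorem5 (R : realType) (I : set R) (gamma beta : R -> 'rV[R]_4)
    (Fgamma Fbeta : frame_field R) :
  open I -> is_interval I ->
  cartan_curve I gamma -> cartan_curve I beta ->
  cartan_frame I gamma Fgamma -> cartan_frame I beta Fbeta ->
  de_sitter_parametrized I Fgamma -> de_sitter_parametrized I Fbeta ->
  (forall sigma : R, I sigma -> shape_tau Fgamma sigma = shape_tau Fbeta sigma) ->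
  (forall sigma : R, I sigma -> shape_kappa Fgamma sigma = shape_kappa Fbeta sigma) ->
  exists f : 'rV[R]_4 -> 'rV[R]_4, p_similarity f /\
    forall sigma : R, I sigma -> beta sigma = f (gamma sigma).
Proof.
move=> oI itvI cg cb fg fb pg pb eqtau eqkappa.
have [[t0 I0]|noI] := pselect (exists t, I t); last first.
  by exists id; split=> [|s Is]; [exact: p_similarity_id | case: noI; exists s].
have [v [dv dFg]] := cartan_frame_speed oI cg fg pg.
have [w [dw dFb]] := cartan_frame_speed oI cb fb pb.
have [mu mu0 wE] : exists2 mu, 0 < mu & forall s, I s -> w s = mu * v s.
  have [v0 _ _ _ _] := dv _ I0; have [w0 _ _ _ _] := dw _ I0.
  exists (w t0 / v t0) => [|s Is]; first by rewrite divr_gt0.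
  have [vs _ _ _ _] := dv _ Is.
  suff -> : w t0 / v t0 = w s / v s by rewrite divfK// gt_eqF.
  (* Both speeds solve the same equation u' = shape_tau u, so their quotient has zero derivative. *)
  apply: (eq_of_derive0 (f := fun u => w u * (v u)^-1) itvI _ I0 Is) => u Iu.
  have [vu _ _ dvu _] := dv _ Iu; have [_ _ _ dwu _] := dw _ Iu.
  have vn0 : v u != 0 by rewrite gt_eqF.
  apply: (is_derive_eq (is_deriveM dwu (is_deriveV vn0 dvu))).
  by rewrite eqtau// /GRing.scale /=; field.
have mun0 : mu != 0 by rewrite gt_eqF.
have tauE s : I s -> tau Fbeta s = tau Fgamma s / mu ^+ 2.
  move=> Is; have [vs eg _ _ _] := dv _ Is; have [_ eb _ _ _] := dw _ Is.
  have m0 : w s ^+ 2 != 0 by rewrite wE// expf_neq0// mulf_neq0// gt_eqF.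
  by apply: (mulfI m0); rewrite eb -eg wE//; field.
have kappaE s : I s -> kappa Fbeta s = kappa Fgamma s / mu ^+ 2.
  move=> Is; have := eqkappa s Is; rewrite /shape_kappa tauE// => e.
  have tn0 : tau Fgamma s != 0 by have [_ _ t_lt0 _ _] := dv _ Is; rewrite lt_eqF.
  have -> : kappa Fbeta s =
    kappa Fbeta s / (tau Fgamma s / mu ^+ 2) * tau Fgamma s / mu ^+ 2.
    by field; rewrite mun0 tn0.
  by rewrite -e divfK.
pose L s := mu^-1 *: frL Fbeta s; pose N s := mu *: frN Fbeta s.
have Fg := cartan_frame_pseudo_orthonormal fg I0.
have Fb : pseudo_orthonormal (L t0) (N t0) (frW1 Fbeta t0) (frW2 Fbeta t0).
  have D := pseudo_orthonormal_dots (cartan_frame_pseudo_orthonormal fb I0).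
  by have [] := @gram_pseudo_orthonormal R (L t0) (N t0) (frW1 Fbeta t0)
    (frW2 Fbeta t0); rewrite ?mdotE ?D ?mulr0 ?mulr1 ?mulVf.
pose phi := frame_map (frL Fgamma t0) (frN Fgamma t0) (frW1 Fgamma t0)
  (frW2 Fgamma t0) (L t0) (N t0) (frW1 Fbeta t0) (frW2 Fbeta t0).
have phiZ (a : R) x : phi (a *: x) = a *: phi x by rewrite /phi linearZ.
have phiL s : I s -> phi (frL Fgamma s) = L s.
  move=> Is.
  (* By constancy [phi] is also the frame map at [s], where its value on [frL Fgamma s] is known. *)
  rewrite /phi (@frame_map_constant R I v (kappa Fgamma) (tau Fgamma)
    (frL Fgamma) (frN Fgamma) (frW1 Fgamma) (frW2 Fgamma)
    L N (frW1 Fbeta) (frW2 Fbeta) itvI _ _ t0 s _ I0 Is).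
  - have Fs := cartan_frame_pseudo_orthonormal fg Is.
    by have [] := frame_map_frame (L s) (N s) (frW1 Fbeta s) (frW2 Fbeta s) Fs.
  - exact: dFg.
  - move=> u Iu; have [dL dN dW1 dW2] := dFb u Iu; split.
    + apply: (is_derive_eq (is_deriveZ mu^-1 dL)).
      by rewrite wE// !scalerA mulKf.
    + apply: (is_derive_eq (is_deriveZ mu dN)).
      by rewrite wE// kappaE// tauE//; apply/rowP=> i; rewrite !mxE; field.
    + apply: (is_derive_eq dW1); rewrite wE// kappaE// /L /N.
      by apply/rowP=> i; rewrite !mxE; field.
    + apply: (is_derive_eq dW2); rewrite wE// tauE// /L.
      by apply/rowP=> i; rewrite !mxE; field.
(* One factor [mu] undoes the rescaling of [L], the other turns the speed [v] into [w]. *)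
have dphi s : I s -> is_derive s 1 (fun u => mu ^+ 2 *: phi (gamma u))
    (w s *: frL Fbeta s).
  move=> Is; have [_ _ _ _ dg] := dv _ Is.
  have dx (a b : 'rV[R]_4) : is_derive s 1 (fun u => mdot (gamma u) a *: b)
      (mdot (v s *: frL Fgamma s) a *: b).
    apply: (is_derive_eq (is_derive_scale
      (is_derive_mdot dg (is_derive_cst a s 1)) (is_derive_cst b s 1))).
    by rewrite mdot0r addr0 scaler0 addr0.
  apply: (is_derive_eq (is_deriveZ (mu ^+ 2) (is_deriveD (is_deriveD (is_deriveD
    (dx (frN Fgamma t0) (L t0)) (dx (frL Fgamma t0) (N t0)))
    (dx (frW1 Fgamma t0) (frW1 Fbeta t0))) (dx (frW2 Fgamma t0) (frW2 Fbeta t0))))).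
  transitivity (mu ^+ 2 *: phi (v s *: frL Fgamma s)) => //.
  rewrite phiZ phiL// wE// /L !scalerA; congr (_ *: _); field.
  by rewrite mun0.
have dotp : 0 < \det (lin1_mx phi).
  apply: det_frame_map_gt0 => //; first by case: fg => _ _ + _ _; exact.
  (* The rescaling by 1 / mu and mu has determinant 1 and preserves the orientation. *)
  have -> : mx_of_rows (L t0) (N t0) (frW1 Fbeta t0) (frW2 Fbeta t0) =
      mx_of_lists [:: [:: mu^-1; 0; 0; 0]; [:: 0; mu; 0; 0];
        [:: 0; 0; 1; 0]; [:: 0; 0; 0; 1]] *m frame_mx Fbeta t0.
    by rewrite mx_of_lists_mul !scale0r !scale1r !addr0 !add0r.
  rewrite det_mulmx det_mx_of_lists.
  have [_ _ /(_ _ I0) detb _ _] := fb; rewrite pmulr_lgt0//.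
  by rewrite [X in 0 < X](_ : _ = 1) ?ltr01//; field.
(* The translation is fixed by agreement at [t0]; equal derivatives extend it to all of [I]. *)
exists (fun x => mu ^+ 2 *: phi x + (beta t0 - mu ^+ 2 *: phi (gamma t0))).
split.
  exists (mu ^+ 2), phi, (beta t0 - mu ^+ 2 *: phi (gamma t0)).
  split=> //; first by rewrite expf_neq0.
  apply: (proper_isometry_null_rotation Fg _ dotp).
  exact: (frame_map_isometric Fg Fb).
move=> s Is.
have dX u : I u -> is_derive u 1 (fun u => beta u - mu ^+ 2 *: phi (gamma u)) 0.
  move=> Iu; have [_ _ _ _ db] := dw _ Iu.
  apply: (is_derive_eq (is_deriveB db (dphi u Iu))).
  by rewrite subrr.
by rewrite -(eq_of_derive0_rV itvI dX Is I0) addrC subrK.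
Qed.
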